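(* Let $L\ge 4$ be even, $A=\{1,L\}$, and let $n,d,e\in\mathbb{N}$ be such that both players are middle class, i.e. $M_1(n)\le d<U_1(n)$ and $M_2(n)\le e<U_2(n)$. Then the winner of $\mathrm{NIM}(A;n;d,e)$ is determined as follows. 1. $n\equiv 0,2,4,\dots,L-2\pmod{2L+2}$: - if $d<M_1(n)+\frac L2-1$, then $W(n;d,e)=2$; - for every integer $k\ge 0$, if $M_1(n)+(L-1)k+\frac L2-1\le d<M_1(n)+(L-1)k+\frac{3L}{2}-2$, then $W(n;d,e)=1$ when $e<M_2(n)+(L-1)k+L-1$, and $W(n;d,e)=2$ when $e\ge M_2(n)+(L-1)k+L-1$; - if $d\ge U_1(n)-L+1$, then $W(n;d,e)=1$ when $e<U_2(n)-L+1$, and $W(n;d,e)=2$ when $e\ge U_2(n)-L+1$. 2. $n\equiv 1,3,5,\dots,L-1,\,2L+1\pmod{2L+2}$: - for every integer $k\ge 0$, if $M_1(n)+(L-1)k\le d<M_1(n)+(L-1)k+L-1$, then $W(n;d,e)=1$ when $e<M_2(n)+(L-1)k+\frac L2-1$, and $W(n;d,e)=2$ when $e\ge M_2(n)+(L-1)k+\frac L2-1$; - if $d\ge U_1(n)-L+1$, then $W(n;d,e)=1$. 3. $n\equiv L,L+2,L+4,\dots,2L\pmod{2L+2}$: - if $d<M_1(n)+\frac L2-1$, then $W(n;d,e)=2$; - for every integer $k\ge 0$, if $M_1(n)+(L-1)k+\frac L2-1\le d<M_1(n)+(L-1)k+\frac{3L}{2}-2$, then $W(n;d,e)=1$ when $e<M_2(n)+(L-1)k+L-1$,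 and $W(n;d,e)=2$ when $e\ge M_2(n)+(L-1)k+L-1$; - if $d\ge U_1(n)-L+1$, then $W(n;d,e)=1$. 4. $n\equiv L+1,L+3,L+5,\dots,2L-1\pmod{2L+2}$: - for every integer $k\ge 0$, if $M_1(n)+(L-1)k\le d<M_1(n)+(L-1)k+L-1$, then $W(n;d,e)=1$ when $e<M_2(n)+(L-1)k+\frac L2-1$, and $W(n;d,e)=2$ when $e\ge M_2(n)+(L-1)k+\frac L2-1$; - if $d\ge U_1(n)-L+1$, then $W(n;d,e)=1$ when $e<U_2(n)-L+1$, and $W(n;d,e)=2$ when $e\ge U_2(n)-L+1$.
   Context: $\mathbb{N}=\{0,1,2,\dots\}$. In the game $\mathrm{NIM}(A;n)$ two players alternate (Player 1 first) removing some $a\in A$ stones from a pile of $n$ stones ($a$ may not exceed the number of stones left); a player who cannot move loses. $W(n)\in\{1,2\}$ is the player with a winning strategy. In the NIM with Cash game $\mathrm{NIM}(A;n;d,e)$, Player 1 starts with $d$ dollars and Player 2 with $e$ dollars. Players alternate, Player 1 first; a move consists of removing some $a\in A$ stones and paying $a$ dollars, where $a$ may exceed neither the number of stones left nor the mover's money. A player who cannot move on his turn loses. $W(n;d,e)\in\{1,2\}$ is the player with a winning strategy. The upper class amounts $U_1(n),U_2(n)\in\mathbb{N}$ are defined recursively (depending on $A$): - If $n<\min(A)$, then $U_1(n)=U_2(n)=0$. - If $n\ge\min(A)$ and $W(n)=1$, then $U_1(n)=\min\{U_2(n-a)+a : a\in A,\ a\le n,\ W(n-a)=2\}$ and $U_2(n)=\max\{U_1(n-a):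 a\in A,\ a\le n\}$. - If $n\ge\min(A)$ and $W(n)=2$, then $U_2(n)=\max\{U_1(n-a): a\in A,\ a\le n\}$ and $U_1(n)=\min\{U_2(n-a)+a : a\in A,\ a\le n,\ U_1(n-a)=U_2(n)\}$. The middle class thresholds are $M_1(n)=\frac n2+1$, $M_2(n)=\frac n2$ for $n$ even, and $M_1(n)=M_2(n)=\frac{n+1}{2}$ for $n$ odd. Player $i$ is middle class when his money is at least $M_i(n)$ and less than $U_i(n)$. *)

(* Defs.v *)
From HB Require Import structures.
From mathcomp Require Import all_boot.
From mathcomp Require Import boolp.
Set Implicit Arguments.
Unset Strict Implicit.
Unset Printing Implicit Defensive.

Inductive player := Player1 | Player2.

Definition is_player1 (i : player) : bool := if i is Player1 then true else false.

Lemma is_player1K :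
  cancel is_player1 (fun b : bool => if b then Player1 else Player2).
Proof. by case. Qed.

HB.instance Definition _ := Equality.copy player (can_type is_player1K).

(* [wins move s b p]: a player who follows the strategy [s] from position [p]
   wins every play, where [b] says whether it is that player's turn; a player
   who cannot move on his turn loses.  Strategies are positional, which is no
   restriction here: the games are finite and positions record the stones and
   the money. *)
Inductive wins (T : Type) (move : T -> T -> Prop) (s : T -> T) :
    bool -> T -> Prop :=
| wins_own p : move p (s p) -> wins move s false (s p) -> wins move s true p
| wins_other p : (forall q, move p q -> wins move s true q) ->
    wins move s false p.

(* Player 1 is the one to move in the starting position [p]. *)
Definition has_winning_strategy (T : Type) (move : T -> T -> Prop)
    (i : player) (p : T) : Prop :=
  exists s : T -> T, wins move s (i == Player1) p.

(* The default value [Player2] is justified by [winnerP]. *)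
Definition winner (T : Type) (move : T -> T -> Prop) (p : T) : player :=
  if `[< has_winning_strategy move Player1 p >] then Player1 else Player2.

Lemma wins_excl (T : Type) (move : T -> T -> Prop) (s s' : T -> T) b (p : T) :
  wins move s b p -> wins move s' (~~ b) p -> False.
Proof.
elim=> {b p} [p mp _ IH | p _ IH] /= w'; inversion w'; subst.
  exact/IH/H.
exact: IH H H0.
Qed.

Lemma winnerP (T : Type) (move : T -> T -> Prop) (f : T -> nat)
    (dec : forall p q, move p q -> f q < f p) (p : T) (i : player) :
  winner move p = i <-> has_winning_strategy move i p.
Proof.
pose N q := has_winning_strategy move Player1 q.
pose s0 q := if pselect (exists r, move q r /\ ~ N r) is left h
             then projT1 (cid h) else q.
have s0P q : (exists r, move q r /\ ~ N r) -> move q (s0 q) /\ ~ N (s0 q).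
  by rewrite /s0; case: pselect => // h _; exact: projT2 (cid h).
have key q : (N q -> wins move s0 true q) /\ (~ N q -> wins move s0 false q).
  have [m] := ubnP (f q); elim: m q => // m IH q; rewrite ltnS => lem.
  have lt r : move q r -> f r < m by move=> /dec /leq_trans; apply.
  split=> [[s ws] | nNq].
    inversion ws; subst.
    have [|mq nN] := s0P q.
      by exists (s q); split=> // -[s' /(wins_excl H0)].
    by apply: wins_own => //; apply: (IH _ (lt _ mq)).2.
  apply: wins_other => r mr; apply: (IH _ (lt _ mr)).1.
  case: (pselect (N r)) => // nNr; case: nNq.
  have [|mq nN] := s0P q; first by exists r.
  by exists s0; apply: wins_own => //; apply: (IH _ (lt _ mq)).2.
rewrite /winner; case: asboolP => [Np | nNp]; case: i; split=> //.
- by case: Np => s ws [s' /(wins_excl ws)].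
- by move=> _; exists s0; exact: (key p).2.
Qed.

(* Throughout, the list [A] stands for a finite nonempty set of positive
   integers. *)
Definition nim_move (A : seq nat) (m m' : nat) : Prop :=
  exists2 a, a \in A & a <= m /\ m' = m - a.

Definition nim_winner (A : seq nat) (n : nat) : player := winner (nim_move A) n.

(* A position is (stones, money of the player to move, money of the other
   player), so the two amounts are exchanged after each move. *)
Definition cash_move (A : seq nat) (p q : nat * nat * nat) : Prop :=
  let: (m, x, y) := p in
  exists2 a, a \in A & [/\ a <= m, a <= x & q = (m - a, y, x - a)].

Definition cash_winner (A : seq nat) (n d e : nat) : player :=
  winner (cash_move A) (n, d, e).

Lemma nim_winnerP (A : seq nat) (n : nat) (i : player) : 0 \notin A ->
  nim_winner A n = i <-> has_winning_strategy (nim_move A) i n.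
Proof.
move=> A0; apply: (winnerP (f := id)) => m m' [a aA [am ->]] /=.
have a0 : 0 < a by rewrite lt0n; apply: contraNneq A0 => <-.
by rewrite ltn_subrL a0 (leq_trans a0 am).
Qed.

Lemma cash_winnerP (A : seq nat) (n d e : nat) (i : player) : 0 \notin A ->
  cash_winner A n d e = i <-> has_winning_strategy (cash_move A) i (n, d, e).
Proof.
move=> A0; apply: (winnerP (f := fun p => p.1.1)) => -[[m x] y] q [a aA].
move=> [am _ ->] /=.
have a0 : 0 < a by rewrite lt0n; apply: contraNneq A0 => <-.
by rewrite ltn_subrL a0 (leq_trans a0 am).
Qed.

(* Minimum of a nonempty list (0 for the empty list). *)
Definition min_seq (s : seq nat) : nat := \big[minn/head 0 s]_(x <- s) x.

(* [(U_1(n), U_2(n))] in terms of the values [U m = (U_1(m), U_2(m))] for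
   [m < n]. *)
Definition upper_step (A : seq nat) (U : nat -> nat * nat) (n : nat) :
    nat * nat :=
  if n < min_seq A then (0, 0) else
  let moves := [seq a <- A | a <= n] in
  let u2 := \max_(a <- moves) (U (n - a)).1 in
  if nim_winner A n == Player1 then
    (min_seq [seq (U (n - a)).2 + a | a <- moves & nim_winner A (n - a) == Player2],
     u2)
  else
    (min_seq [seq (U (n - a)).2 + a | a <- moves & (U (n - a)).1 == u2], u2).

(* The table of the values of [(U_1, U_2)] at 0, ..., n - 1. *)
Fixpoint upper_table (A : seq nat) (n : nat) : seq (nat * nat) :=
  if n is m.+1 then
    let t := upper_table A m in rcons t (upper_step A (nth (0, 0) t) m)
  else [::].

Definition upper (A : seq nat) (n : nat) : nat * nat :=
  nth (0, 0) (upper_table A n.+1) n.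

Definition U1 (A : seq nat) (n : nat) : nat := (upper A n).1.
Definition U2 (A : seq nat) (n : nat) : nat := (upper A n).2.

Lemma size_upper_table (A : seq nat) (n : nat) : size (upper_table A n) = n.
Proof. by elim: n => //= n IH; rewrite size_rcons IH. Qed.

Lemma nth_upper_table (A : seq nat) (n m : nat) : m < n ->
  nth (0, 0) (upper_table A n) m = upper A m.
Proof.
elim: n => // n IH; rewrite ltnS leq_eqVlt => /predU1P [-> // | mn] /=.
by rewrite nth_rcons size_upper_table mn IH.
Qed.

Lemma upperE (A : seq nat) (n : nat) : 0 \notin A ->
  upper A n = upper_step A (upper A) n.
Proof.
move=> A0; rewrite {1}/upper /= nth_rcons size_upper_table ltnn eqxx.
rewrite /upper_step; case: ifP => // _.
set B := [seq a <- A | a <= n].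
have E a : a \in B -> nth (0, 0) (upper_table A n) (n - a) = upper A (n - a).
  rewrite mem_filter => /andP [an aA]; apply: nth_upper_table.
  have a0 : 0 < a by rewrite lt0n; apply: contraNneq A0 => <-.
  by rewrite ltn_subrL a0 (leq_trans a0 an).
have -> : \max_(a <- B) (nth (0, 0) (upper_table A n) (n - a)).1
          = \max_(a <- B) (upper A (n - a)).1.
  by apply: eq_big_seq => a /E ->.
case: ifP => _; congr (min_seq _, _).
  by apply/eq_in_map => a; rewrite mem_filter => /andP [_ /E ->].
rewrite (@eq_in_filter _ _ (fun a =>
  (upper A (n - a)).1 == \max_(b <- B) (upper A (n - b)).1)).
  by apply/eq_in_map => a; rewrite mem_filter => /andP [_ /E ->].
by move=> a /E ->.
Qed.

Definition M1 (n : nat) : nat := if odd n then n.+1./2 else n./2 + 1.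
Definition M2 (n : nat) : nat := if odd n then n.+1./2 else n./2.

Definition middle_class1 (A : seq nat) (n d : nat) : bool :=
  M1 n <= d < U1 A n.
Definition middle_class2 (A : seq nat) (n e : nat) : bool :=
  M2 n <= e < U2 A n.

(* Main.v *)
(* For every n the winner is determined, for all amounts of money, by a
   staircase: as long as nobody is poor, the money needed to win against e
   dollars is constant on blocks of L - 1 consecutive values of e and then jumps
   by L - 1.  Removing one stone maps the staircase of n to that of n - 1, with
   the roles of the players exchanged, and removing L stones maps its top step to
   the top step for n - L.  Beyond the top step the winner of NIM without
   cash prevails; U_1 and U_2 lie at the top, so middle class players only see
   the staircase. *)
Require Import Defs.
From mathcomp Require Import all_boot zify.
Set Implicit Arguments.
Unset Strict Implicit.
Unset Printing Implicit Defensive.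

(** * One-move recursions for the winners *)

(** Positions are seen from the player about to move, so a move exchanges the roles. A strategy of
    [Player2] at [p] serves [Player1] at every successor, which yields the converse by
    contradiction. *)
Lemma winner_stepP (T : Type) (move : T -> T -> Prop) (f : T -> nat)
    (dec : forall p q, move p q -> f q < f p) (p : T) :
  winner move p = Player1 <-> exists2 q, move p q & winner move q = Player2.
Proof.
split=> [/(winnerP dec) [s ws] | [q mq wq]].
  inversion ws; subst; exists (s p) => //.
  by apply/(winnerP dec); exists s.
case wp: (winner move p) => //.
case/(winnerP dec): wp => s ws; inversion ws; subst.
have /(winnerP dec) : has_winning_strategy move Player1 q by exists s; exact: H.
by rewrite wq.
Qed.

Lemma nim_winnerE (L n : nat) : 0 < L ->
  nim_winner [:: 1; L] n = Player1 <->
  (0 < n /\ nim_winner [:: 1; L] (n - 1) = Player2) \/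
  (L <= n /\ nim_winner [:: 1; L] (n - L) = Player2).
Proof.
move=> L0; rewrite /nim_winner (winner_stepP (f := id)); last first.
  by move=> m m' [a]; rewrite !inE => /orP [] /eqP -> [? ->] /=; lia.
split=> [[m [a]] | [[n0 w] | [nL w]]].
- by rewrite !inE => /orP [] /eqP -> [? ->]; [left | right].
- by exists (n - 1) => //; exists 1; rewrite ?inE.
- by exists (n - L) => //; exists L; rewrite ?inE ?eqxx ?orbT.
Qed.

Lemma cash_winnerE (L n d e : nat) : 0 < L ->
  cash_winner [:: 1; L] n d e = Player1 <->
  [/\ 0 < n, 0 < d & cash_winner [:: 1; L] (n - 1) e (d - 1) = Player2] \/
  [/\ L <= n, L <= d & cash_winner [:: 1; L] (n - L) e (d - L) = Player2].
Proof.
move=> L0; rewrite /cash_winner (winner_stepP (f := fun p => p.1.1)); last first.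
  by move=> [[n1 d1] e1] q [a]; rewrite !inE => /orP [] /eqP -> [? ? ->] /=; lia.
split=> [[q [a]] | [[n0 d0 w] | [nL dL w]]].
- by rewrite !inE => /orP [] /eqP -> [? ? ->]; [left | right].
- by exists (n - 1, e, d - 1) => //; exists 1; rewrite ?inE.
- by exists (n - L, e, d - L) => //; exists L; rewrite ?inE ?eqxx ?orbT.
Qed.

Lemma cash_winner2 (L n d e : nat) : 0 < L ->
  (0 < n -> 0 < d -> cash_winner [:: 1; L] (n - 1) e (d - 1) = Player1) ->
  (L <= n -> L <= d -> cash_winner [:: 1; L] (n - L) e (d - L) = Player1) ->
  cash_winner [:: 1; L] n d e = Player2.
Proof.
move=> L0 w1 wL; case w: (cash_winner _ n d e) => //.
by case/(cash_winnerE _ _ _ L0): w => -[n0 d0]; [rewrite w1 | rewrite wL].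
Qed.

(** * The staircase with cash *)

(* The pile is [n = 2 * m] (even case) or [n + 1 = 2 * m] (odd case), with
   [m = (T + 2) * q + s], [s < T + 2] and [L = T + 1 = 2 * h]; the player to move
   has [d] dollars, his opponent [e].  In each definition the clauses are, in
   order: some player is poor; the k-th step of the staircase decides; the winner
   reaches the top of the staircase (step [q]) and wins against any amount. *)
Definition even_win (T h m q s d e : nat) : Prop :=
  [\/ e < m /\ e < d,
      exists2 k, k < q & e < m + T * k + T /\ m + h + T * k <= d
    | h <= s /\ m + h + T * q <= d].

Definition even_lose (T h m q s d e : nat) : Prop :=
  [\/ d <= e /\ d <= m,
      exists2 k, k <= q & d < m + h + T * k /\ m + T * k <= e
    | s < h /\ m + T * q <= e].

Definition odd_win (T h m q s d e : nat) : Prop :=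
  [\/ e < m /\ e < d,
      exists2 k, k <= q & e < m + T * k + h - 1 /\ m + T * k <= d
    | s <= h /\ m + T * q <= d].

Definition odd_lose (T h m q s d e : nat) : Prop :=
  [\/ d <= e /\ d < m,
      exists2 k, k < q & d < m + T * k + T /\ m + T * k + h - 1 <= e
    | h < s /\ m + T * q + h - 1 <= e].

(** Both parities go through one induction, since one stone changes the parity: it keeps [m] from an
    even pile and lowers it by 1 from an odd one, while L stones keep the parity and lower [m] by
    [h]. Each winning clause has a move into a losing clause; both moves carry each losing clause
    into winning ones. *)
Lemma cash_values (T h n m q s d e : nat) :
  0 < h -> T.+1 = 2 * h -> m = (T + 2) * q + s -> s < T + 2 ->
  let W := cash_winner [:: 1; T.+1] in
  (n = 2 * m -> (even_win T h m q s d e -> W n d e = Player1) /\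
                (even_lose T h m q s d e -> W n d e = Player2)) /\
  (n.+1 = 2 * m -> (odd_win T h m q s d e -> W n d e = Player1) /\
                   (odd_lose T h m q s d e -> W n d e = Player2)).
Proof.
move=> h0 Th + + W; elim/ltn_ind: n m q s d e => n IH m q s d e mE sT.
have mono a b : a <= b -> T * a <= T * b by move=> ab; rewrite leq_mul2l ab orbT.
have IHe a m' q' s' : 0 < a <= n -> n - a = 2 * m' -> m' = (T + 2) * q' + s' ->
    s' < T + 2 ->
    (even_win T h m' q' s' e (d - a) -> W (n - a) e (d - a) = Player1) /\
    (even_lose T h m' q' s' e (d - a) -> W (n - a) e (d - a) = Player2).
  by move=> an nE E l; apply: (IH _ _ m' q' s' e (d - a) E l).1; lia.
have IHo a m' q' s' : 0 < a <= n -> (n - a).+1 = 2 * m' ->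
    m' = (T + 2) * q' + s' -> s' < T + 2 ->
    (odd_win T h m' q' s' e (d - a) -> W (n - a) e (d - a) = Player1) /\
    (odd_lose T h m' q' s' e (d - a) -> W (n - a) e (d - a) = Player2).
  by move=> an nE E l; apply: (IH _ _ m' q' s' e (d - a) E l).2; lia.
have winE := cash_winnerE n d e (ltn0Sn T).
split=> nE; split.
- case=> [[em ed] | [k kq [em md]] | [hs md]].
  + apply/winE; left; split; [lia | lia |].
    by apply: (IHo 1 m q s _ _ _ _).2; [lia.. | apply: Or31; lia].
  + apply/winE; left; split; [lia | lia |].
    by apply: (IHo 1 m q s _ _ _ _).2; [lia.. | apply: Or32; exists k; lia].
  (* One stone works unless [s = h], where the odd pile left would still favour its mover; L stones
     then lead to [s = 0]. *)
  + case: (ltnP h s) => hs'; apply/winE; [left | right]; split; [lia | lia | | lia | lia |].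
      by apply: (IHo 1 m q s _ _ _ _).2; [lia.. | apply: Or33; lia].
    by apply: (IHe T.+1 (m - h) q 0 _ _ _ _).2; [lia.. | apply: Or33; lia].
- case=> [[de dm] | [k kq [dm me]] | [hs me]]; apply: cash_winner2 => // n0 d0.
  + by apply: (IHo 1 m q s _ _ _ _).1; [lia.. | apply: Or31; lia].
  + case: (ltnP s h) => hs; last first.
      by apply: (IHe T.+1 (m - h) q (s - h) _ _ _ _).1; [lia.. | apply: Or31; lia].
    (* L stones cross into the previous block of [m], and [s + h + 1 = s - h + (T + 2)]; [q = 0]
       would leave fewer than L stones. *)
    case: q => [|q] in mE *; first lia.
    by apply: (IHe T.+1 (m - h) q (s + h + 1) _ _ _ _).1; [lia.. | apply: Or31; lia].
  + by apply: (IHo 1 m q s _ _ _ _).1; [lia.. | apply: Or32; exists k; lia].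
  (* L stones turn losing step [k] into winning step [k - 1]. The second disjunct covers
     [k - 1 = q'], where the top clause, which needs [h <= s'], replaces the missing step. *)
  + have [q' [s' [E l kq']]] : exists q' s', [/\ m - h = (T + 2) * q' + s',
        s' < T + 2 & k <= q' \/ k <= q'.+1 /\ h <= s'].
      case: (ltnP s h) => hs; last by exists q, (s - h); split; lia.
      case: q => [|q] in mE kq *; first lia.
      by exists q, (s + h + 1); split; lia.
    apply: (IHe T.+1 (m - h) q' s' _ _ _ _).1; [lia.. |].
    case: k => [|k] in kq dm me kq' *; first by apply: Or31; lia.
    case: (ltnP k q') => kl; first by apply: Or32; exists k; lia.
    have -> : q' = k by lia.
    by apply: Or33; lia.
  + by apply: (IHo 1 m q s _ _ _ _).1; [lia.. | apply: Or33; lia].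
  + case: q => [|q] in mE me *; first lia.
    by apply: (IHe T.+1 (m - h) q (s + h + 1) _ _ _ _).1; [lia.. | apply: Or33; lia].
- case=> [[em ed] | [k kq [em md]] | [hs md]].
  + apply/winE; left; split; [lia | lia |].
    case: s => [|s] in mE sT *; last first.
      by apply: (IHe 1 (m - 1) q s _ _ _ _).2; [lia.. | apply: Or31; lia].
    case: q => [|q] in mE *; first lia.
    by apply: (IHe 1 (m - 1) q T.+1 _ _ _ _).2; [lia.. | apply: Or31; lia].
  + case: s => [|s] in mE sT *; last first.
      apply/winE; left; split; [lia | lia |].
      by apply: (IHe 1 (m - 1) q s _ _ _ _).2; [lia.. | apply: Or32; exists k; lia].
    case: q => [|q] in mE kq *; first lia.
    case: (ltnP q k) => qk; last first.
      apply/winE; left; split; [lia | lia |].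
      by apply: (IHe 1 (m - 1) q T.+1 _ _ _ _).2; [lia.. | apply: Or32; exists k; lia].
    (* The staircase of [n - 1] ends at step [q], so one stone is not enough; L stones reach the
       region beyond the top step. *)
    have Ek : k = q.+1 by lia.
    subst k; apply/winE; right; split; [lia | lia |].
    by apply: (IHo T.+1 (m - h) q h.+1 _ _ _ _).2; [lia.. | apply: Or33; lia].
  + case: s => [|s] in mE sT hs *; apply/winE; last first.
      left; split; [lia | lia |].
      by apply: (IHe 1 (m - 1) q s _ _ _ _).2; [lia.. | apply: Or33; lia].
    case: q => [|q] in mE md *; first lia.
    right; split; [lia | lia |].
    by apply: (IHo T.+1 (m - h) q h.+1 _ _ _ _).2; [lia.. | apply: Or33; lia].
- move=> lose; apply: cash_winner2 => // n0 d0.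
  + case: s => [|s] in mE sT lose *; last first.
      apply: (IHe 1 (m - 1) q s _ _ _ _).1; [lia.. |].
      case: lose => [[de dm] | [k kq [dm me]] | [hs me]].
      * by apply: Or31; lia.
      * by apply: Or32; exists k; lia.
      * by apply: Or33; lia.
    case: q => [|q] in mE lose *; first lia.
    apply: (IHe 1 (m - 1) q T.+1 _ _ _ _).1; [lia.. |].
    case: lose => [[de dm] | [k kq [dm me]] | [hs me]]; last lia.
      by apply: Or31; lia.
    (* At [k = q] the pile [n - 1] has no winning step left, and its top clause takes over. *)
    case: (ltnP k q) => kq'; first by apply: Or32; exists k; lia.
    have Ek : k = q by lia.
    by subst k; apply: Or33; lia.
  (* Unlike for even piles, L stones preserve the step index [k] here. *)
  + case: (ltnP s h) => hs; last first.
      apply: (IHo T.+1 (m - h) q (s - h) _ _ _ _).1; [lia.. |].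
      case: lose => [[de dm] | [k kq [dm me]] | [hs' me]].
      * by apply: Or31; lia.
      * by apply: Or32; exists k; lia.
      * by apply: Or33; lia.
    case: q => [|q] in mE lose *; first lia.
    apply: (IHo T.+1 (m - h) q (s + h + 1) _ _ _ _).1; [lia.. |].
    case: lose => [[de dm] | [k kq [dm me]] | [hs' me]]; last lia.
      by apply: Or31; lia.
    by apply: Or32; exists k; lia.
Qed.

(** * NIM without cash *)

(** The losing residues modulo L + 1 are 0, 2, ..., L - 2. As L + 1 is odd, two periods are needed
    to fix the parity of [n]; they give [s < h] for even and [s > h] for odd piles. *)
Lemma nim_values (T h n m q s : nat) :
  0 < h -> T.+1 = 2 * h -> m = (T + 2) * q + s -> s < T + 2 ->
  let W := nim_winner [:: 1; T.+1] in
  (n = 2 * m -> W n = if s < h then Player2 else Player1) /\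
  (n.+1 = 2 * m -> W n = if s <= h then Player1 else Player2).
Proof.
move=> h0 Th + + W; elim/ltn_ind: n m q s => n IH m q s mE sT.
have IHe a m' q' s' : 0 < a <= n -> n - a = 2 * m' -> m' = (T + 2) * q' + s' ->
    s' < T + 2 -> W (n - a) = if s' < h then Player2 else Player1.
  by move=> an nE E l; apply: (IH _ _ m' q' s' E l).1; lia.
have IHo a m' q' s' : 0 < a <= n -> (n - a).+1 = 2 * m' ->
    m' = (T + 2) * q' + s' -> s' < T + 2 ->
    W (n - a) = if s' <= h then Player1 else Player2.
  by move=> an nE E l; apply: (IH _ _ m' q' s' E l).2; lia.
have winE : W n = Player1 <-> _ := nim_winnerE n (ltn0Sn T).
have loseE : (0 < n -> W (n - 1) = Player1) ->
    (T < n -> W (n - T.+1) = Player1) -> W n = Player2.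
  move=> w1 wT; case w: (W n) => //.
  by case/winE: w => -[n0]; rewrite -/W; [rewrite w1 | rewrite wT].
split=> nE.
- case: ltnP => hs; [apply: loseE => n0 | apply/winE].
  + by rewrite (IHo 1 m q s); [rewrite ltnW | lia..].
  + case: q => [|q] in mE *; first lia.
    by rewrite (IHe T.+1 (m - h) q (s + h + 1)); [case: ltnP => //; lia | lia..].
  + case: (ltnP h s) => hs'; [left | right]; split; [lia | | lia |].
      by rewrite -/W (IHo 1 m q s); [case: leqP => //; lia | lia..].
    by rewrite -/W (IHe T.+1 (m - h) q 0); [rewrite h0 | lia..].
- case: leqP => hs; [apply/winE | apply: loseE => n0].
  + case: s => [|s] in mE sT hs *; last first.
      left; split; first lia.
      by rewrite -/W (IHe 1 (m - 1) q s); [rewrite hs | lia..].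
    case: q => [|q] in mE *; first lia.
    right; split; first lia.
    by rewrite -/W (IHo T.+1 (m - h) q h.+1); [case: leqP => //; lia | lia..].
  + by rewrite (IHe 1 (m - 1) q (s - 1)); [case: ltnP => //; lia | lia..].
  + by rewrite (IHo T.+1 (m - h) q (s - h)); [case: leqP => //; lia | lia..].
Qed.

(** * Upper class amounts *)

Lemma min_seq1 x : min_seq [:: x] = x.
Proof. by rewrite /min_seq big_cons big_nil minnn. Qed.

Lemma min_seq2 x y : min_seq [:: x; y] = minn x y.
Proof. by rewrite /min_seq !big_cons big_nil /= minnCA minnn minnC. Qed.

(** Only one stone can be taken, and this move always satisfies the side condition of the
    minimum. *)
Lemma upper_lt (L n : nat) : 0 < n < L ->
  U1 [:: 1; L] n = U2 [:: 1; L] (n - 1) + 1 /\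
  U2 [:: 1; L] n = U1 [:: 1; L] (n - 1).
Proof.
move=> nL; have L0 : 0 < L by lia.
have A0 : 0 \notin [:: 1; L] by rewrite !inE; lia.
have nE : (n < min_seq [:: 1; L]) = false by rewrite min_seq2; lia.
have LE : (L <= n) = false by lia.
have n1 : 0 < n by lia.
rewrite /U1 /U2 upperE // /upper_step nE /= n1 LE big_cons big_nil maxn0 /=.
case: eqP => [|_] /=; last by rewrite eqxx /= min_seq1.
case/nim_winnerE=> // -[]; last lia.
by move=> _ ->; rewrite eqxx /= min_seq1.
Qed.

(** [c a] tells whether removing [a] stones enters the minimum; the final 0 is the value of
    [min_seq] on the empty list. *)
Lemma upper_ge (L n : nat) : 0 < L <= n ->
  let c a := if nim_winner [:: 1; L] n == Player1
             then nim_winner [:: 1; L] (n - a) == Player2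
             else U1 [:: 1; L] (n - a) == U2 [:: 1; L] n in
  let u a := U2 [:: 1; L] (n - a) + a in
  U2 [:: 1; L] n = maxn (U1 [:: 1; L] (n - 1)) (U1 [:: 1; L] (n - L)) /\
  U1 [:: 1; L] n = if c 1 then if c L then minn (u 1) (u L) else u 1
                   else if c L then u L else 0.
Proof.
move=> /andP [L0 nL] c u.
have A0 : 0 \notin [:: 1; L] by rewrite !inE; lia.
have nE : (n < min_seq [:: 1; L]) = false by rewrite min_seq2; lia.
have n1 : 0 < n by lia.
have E2 : U2 [:: 1; L] n = maxn (U1 [:: 1; L] (n - 1)) (U1 [:: 1; L] (n - L)).
  by rewrite /U1 /U2 upperE // /upper_step nE /= n1 nL !big_cons big_nil /= maxn0;
     case: ifP.
split=> //; rewrite /c /u E2 /U1 /U2 upperE // /upper_step nE /= n1 nL.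
rewrite !big_cons big_nil maxn0.
by case: (nim_winner _ n == _) => /=; do 2!case: ifP => _;
   rewrite /= ?min_seq1 ?min_seq2 // /min_seq big_nil.
Qed.

Ltac split_ifs := repeat match goal with
  | |- context [if ?b then _ else _] =>
    lazymatch b with
    | context [if _ then _ else _] => fail
    | _ => case: (boolP b) => ? /=
    end
  end.

(* The case [q == 0] is genuinely different: there the recursion for the upper
   class amounts has not yet entered its periodic regime. *)
Lemma upper_values (T h n m q s : nat) :
  0 < h -> T.+1 = 2 * h -> m = (T + 2) * q + s -> s < T + 2 ->
  let u1 := U1 [:: 1; T.+1] n in
  let u2 := U2 [:: 1; T.+1] n in
  (n = 2 * m ->
     u1 = (if s < h then if q == 0 then s else m + T * q + 1 - h
           else m + T * q + h) /\
     u2 = m + T * q) /\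
  (n.+1 = 2 * m ->
     u1 = m + T * q /\
     u2 = (if s <= h then if q == 0 then s - 1 else m + T * q - h
           else m + T * q + h - 1)).
Proof.
move=> h0 Th; elim/ltn_ind: n m q s => n IH m q s mE sT.
have IHe a m' q' s' : 0 < a <= n -> n - a = 2 * m' -> m' = (T + 2) * q' + s' ->
    s' < T + 2 -> _ :=
  fun an nE E l => (IH (n - a) ltac:(lia) m' q' s' E l).1 nE.
have IHo a m' q' s' : 0 < a <= n -> (n - a).+1 = 2 * m' ->
    m' = (T + 2) * q' + s' -> s' < T + 2 -> _ :=
  fun an nE E l => (IH (n - a) ltac:(lia) m' q' s' E l).2 nE.
have We a m' q' s' : n - a = 2 * m' -> m' = (T + 2) * q' + s' -> s' < T + 2 -> _ :=
  fun nE E l => (nim_values (n - a) h0 Th E l).1 nE.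
have Wo a m' q' s' : (n - a).+1 = 2 * m' -> m' = (T + 2) * q' + s' -> s' < T + 2 -> _ :=
  fun nE E l => (nim_values (n - a) h0 Th E l).2 nE.
have PE b : ((if b then Player1 else Player2) == Player1 = b) *
    ((if b then Player1 else Player2) == Player2 = ~~ b) *
    ((if b then Player2 else Player1) == Player1 = ~~ b) *
    ((if b then Player2 else Player1) == Player2 = b) by case: b.
case: (posnP n) => [-> /= | n0].
  have U0 : upper [:: 1; T.+1] 0 = (0, 0).
    by rewrite upperE ?inE // /upper_step min_seq2 leq_min.
  rewrite /U1 /U2 U0 /=; split=> [m0|]; last lia.
  have -> : m = 0 by lia.
  have [-> ->] : q = 0 /\ s = 0 by split; nia.
  by rewrite h0 muln0.
have [nT|nT] := ltnP n T.+1.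
  have [-> ->] := upper_lt (L := T.+1) (n := n) ltac:(lia).
  split=> nE; (have q0 : q = 0 by nia); rewrite q0 in mE *.
    have [||||-> ->] := IHo 1 m 0 s; [lia.. |].
    by split_ifs; lia.
  have [||||-> ->] := IHe 1 (m - 1) 0 (s - 1); [lia.. |].
  by split_ifs; lia.
have [E2 E1] := upper_ge (L := T.+1) (n := n) ltac:(lia).
split=> nE.
- have [||||x1 x2] := IHo 1 m q s; [lia.. |].
  have v1 := Wo 1 m q s ltac:(lia) mE sT.
  have v := (nim_values n h0 Th mE sT).1 nE.
  have [hs|hs] := leqP h s.
    have [||||y1 y2] := IHe T.+1 (m - h) q (s - h); [lia.. |].
    have v2 := We T.+1 (m - h) q (s - h) ltac:(lia) ltac:(lia) ltac:(lia).
    move: E1 E2; rewrite x1 x2 y1 y2 v v1 v2 !PE.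
    split_ifs; lia.
  (* [q = 0] with [s < h] would mean fewer than L stones. *)
  case: q => [|q] in mE x1 x2 *; first lia.
  have [||||y1 y2] := IHe T.+1 (m - h) q (s + h + 1); [lia.. |].
  have v2 := We T.+1 (m - h) q (s + h + 1) ltac:(lia) ltac:(lia) ltac:(lia).
  move: E1 E2; rewrite x1 x2 y1 y2 v v1 v2 !PE.
  split_ifs; lia.
have v := (nim_values n h0 Th mE sT).2 nE.
case: s => [|s] in mE sT v *.
  case: q => [|q] in mE *; first lia.
  have [||||x1 x2] := IHe 1 (m - 1) q T.+1; [lia.. |].
  have v1 := We 1 (m - 1) q T.+1 ltac:(lia) ltac:(lia) ltac:(lia).
  have [||||y1 y2] := IHo T.+1 (m - h) q h.+1; [lia.. |].
  have v2 := Wo T.+1 (m - h) q h.+1 ltac:(lia) ltac:(lia) ltac:(lia).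
  move: E1 E2; rewrite x1 x2 y1 y2 v v1 v2 !PE.
  split_ifs; lia.
have [||||x1 x2] := IHe 1 (m - 1) q s; [lia.. |].
have v1 := We 1 (m - 1) q s ltac:(lia) ltac:(lia) ltac:(lia).
have [hs|hs] := leqP h s.+1.
  have [||||y1 y2] := IHo T.+1 (m - h) q (s.+1 - h); [lia.. |].
  have v2 := Wo T.+1 (m - h) q (s.+1 - h) ltac:(lia) ltac:(lia) ltac:(lia).
  move: E1 E2; rewrite x1 x2 y1 y2 v v1 v2 !PE.
  split_ifs; lia.
case: q => [|q] in mE x1 x2 *; first lia.
have [||||y1 y2] := IHo T.+1 (m - h) q (s.+1 + h + 1); [lia.. |].
have v2 := Wo T.+1 (m - h) q (s.+1 + h + 1) ltac:(lia) ltac:(lia) ltac:(lia).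
move: E1 E2; rewrite x1 x2 y1 y2 v v1 v2 !PE.
split_ifs; lia.
Qed.

(** * The middle class *)

(* The bounds U_i(n) - L + 1 are written [U_i n + 1 - L]: compared with a
   natural number, truncation at 0 then makes no difference. *)
Theorem theorem6p4 (L n d e : nat) :
  let A := [:: 1; L] in
  4 <= L -> ~~ odd L ->
  middle_class1 A n d -> middle_class2 A n e ->
  let W := cash_winner A in
  let r := n %% (2 * L + 2) in
  [/\ (~~ odd r /\ r <= L - 2 ->
        [/\ (d < M1 n + L./2 - 1 -> W n d e = Player2),
            (forall k : nat,
               M1 n + (L - 1) * k + L./2 - 1 <= d
                 < M1 n + (L - 1) * k + (3 * L)./2 - 2 ->
               (e < M2 n + (L - 1) * k + L - 1 -> W n d e = Player1) /\
               (M2 n + (L - 1) * k + L - 1 <= e -> W n d e = Player2))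
          & (U1 A n + 1 - L <= d ->
               (e < U2 A n + 1 - L -> W n d e = Player1) /\
               (U2 A n + 1 - L <= e -> W n d e = Player2))]),
      ((odd r /\ r <= L - 1) \/ r = 2 * L + 1 ->
        (forall k : nat,
           M1 n + (L - 1) * k <= d < M1 n + (L - 1) * k + L - 1 ->
           (e < M2 n + (L - 1) * k + L./2 - 1 -> W n d e = Player1) /\
           (M2 n + (L - 1) * k + L./2 - 1 <= e -> W n d e = Player2)) /\
        (U1 A n + 1 - L <= d -> W n d e = Player1)),
      (~~ odd r /\ L <= r <= 2 * L ->
        [/\ (d < M1 n + L./2 - 1 -> W n d e = Player2),
            (forall k : nat,
               M1 n + (L - 1) * k + L./2 - 1 <= d
                 < M1 n + (L - 1) * k + (3 * L)./2 - 2 ->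
               (e < M2 n + (L - 1) * k + L - 1 -> W n d e = Player1) /\
               (M2 n + (L - 1) * k + L - 1 <= e -> W n d e = Player2))
          & (U1 A n + 1 - L <= d -> W n d e = Player1)])
    & (odd r /\ L + 1 <= r <= 2 * L - 1 ->
        (forall k : nat,
           M1 n + (L - 1) * k <= d < M1 n + (L - 1) * k + L - 1 ->
           (e < M2 n + (L - 1) * k + L./2 - 1 -> W n d e = Player1) /\
           (M2 n + (L - 1) * k + L./2 - 1 <= e -> W n d e = Player2)) /\
        (U1 A n + 1 - L <= d ->
           (e < U2 A n + 1 - L -> W n d e = Player1) /\
           (U2 A n + 1 - L <= e -> W n d e = Player2)))].
Proof.
move=> A; case: L @A => // T A; rewrite {}/A /middle_class1 /middle_class2.
move=> T4 Tev dM eM; set W := cash_winner _; set r := n %% _.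
have [h Th] : exists h, T.+1 = 2 * h by exists T.+1./2; lia.
have h0 : 0 < h by lia.
have -> : T.+1./2 = h by lia.
have -> : (3 * T.+1)./2 = 3 * h by lia.
have -> : T.+1 - 1 = T by lia.
have mono a b : a <= b -> T * a <= T * b by move=> ab; rewrite leq_mul2l ab orbT.
have nE := divn_eq n (2 * T.+1 + 2); rewrite -/r in nE.
have rL : r < 2 * T.+1 + 2 by rewrite ltn_mod addn2.
have on : odd n = odd r by rewrite {1}nE oddD oddM oddD oddM andbF.
move: (n %/ _) nE => q nE.
have coord_odd : odd r -> exists m q' s, [/\ n.+1 = 2 * m, m = (T + 2) * q' + s,
    s < T + 2 & s = r.+1./2 \/ s = 0 /\ r = 2 * T.+1 + 1].
  move=> rodd; case: (ltnP r (2 * T.+1 + 1)) => rl.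
    by exists n.+1./2, q, r.+1./2; split; lia.
  (* The residue 2L + 1 would give [s = T + 2], hence starts the next block. *)
  by exists n.+1./2, q.+1, 0; split; lia.
have coord_even : ~~ odd r -> [/\ n = 2 * n./2, n./2 = (T + 2) * q + r./2 &
    r./2 < T + 2] by move=> rev; split; lia.
split.
- case=> rev rl; have [n2 mE sT] := coord_even rev.
  move: dM eM; rewrite /M1 /M2 on (negbTE rev).
  have [win lose] := (cash_values n d e h0 Th mE sT).1 n2.
  have [-> ->] := (upper_values n h0 Th mE sT).1 n2.
  have -> : r./2 < h by lia.
  move: (n./2) mE win lose => m mE win lose {n2 on coord_odd coord_even}.
  (* In the first block a middle class interval is empty: here U_1(n) = [s] < M_1(n). *)
  case: q => [|q] in nE mE win lose *; first by move=> /= dM eM; lia.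
  move=> /= dM eM; split=> [dl | k dk | dl].
  + by apply: lose; apply: Or32; exists 0; lia.
  (* Later steps would force [d] to be at least U_1(n). *)
  + have kq : k < q.+1 by rewrite ltnNge; apply/negP => /mono; lia.
    split=> el; first by apply: win; apply: Or32; exists k; lia.
    (* The upper bound on [d] is the threshold of losing step [k + 1]. *)
    by apply: lose; apply: Or32; exists k.+1; lia.
  + split=> el; last by apply: lose; apply: Or32; exists q; lia.
    (* In block 1, U_2(n) - L + 1 equals M_2(n), so no middle class [e] lies below it. *)
    case: q => [|q] in mE nE win lose dM eM dl el *; first by lia.
    by apply: win; apply: Or32; exists q; lia.
- move=> rc; have rodd : odd r by lia.
  have [m [q' [s [n2 mE sT sr]]]] := coord_odd rodd.
  move: dM eM; rewrite /M1 /M2 on rodd.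
  have [win lose] := (cash_values n d e h0 Th mE sT).2 n2.
  have [-> ->] := (upper_values n h0 Th mE sT).2 n2.
  have -> : s <= h by lia.
  have -> : n.+1./2 = m by lia.
  clear n2 on nE coord_odd coord_even.
  case: q' => [|q'] in mE win lose *; first by move=> /= dM eM; lia.
  move=> /= dM eM; split=> [k dk | dl].
  + have kq : k < q'.+1 by rewrite ltnNge; apply/negP => /mono; lia.
    split=> el; first by apply: win; apply: Or32; exists k; lia.
    by apply: lose; apply: Or32; exists k; lia.
  (* U_2(n) is exactly the bound on [e] in step [q'], so every middle class [e] loses. *)
  + by apply: win; apply: Or32; exists q'; lia.
- case=> rev rl; have [n2 mE sT] := coord_even rev.
  move: dM eM; rewrite /M1 /M2 on (negbTE rev).
  have [win lose] := (cash_values n d e h0 Th mE sT).1 n2.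
  have [-> ->] := (upper_values n h0 Th mE sT).1 n2.
  have -> : (r./2 < h) = false by lia.
  move: (n./2) mE win lose => m mE win lose {n2 on coord_odd coord_even}.
  case: q => [|q] in nE mE win lose *; first by move=> /= dM eM; lia.
  move=> /= dM eM; split=> [dl | k dk | dl].
  + by apply: lose; apply: Or32; exists 0; lia.
  + have kq : k < q.+1 by rewrite ltnNge; apply/negP => /mono; lia.
    split=> el; first by apply: win; apply: Or32; exists k; lia.
    by apply: lose; apply: Or32; exists k.+1; lia.
  + by apply: win; apply: Or32; exists q; lia.
- case=> rodd rl; have [m [q' [s [n2 mE sT sr]]]] := coord_odd rodd.
  move: dM eM; rewrite /M1 /M2 on rodd.
  have [win lose] := (cash_values n d e h0 Th mE sT).2 n2.
  have [-> ->] := (upper_values n h0 Th mE sT).2 n2.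
  have -> : (s <= h) = false by lia.
  have -> : n.+1./2 = m by lia.
  clear n2 on nE coord_odd coord_even.
  case: q' => [|q'] in mE win lose *; first by move=> /= dM eM; lia.
  move=> /= dM eM; split=> [k dk | dl].
  + have kq : k < q'.+1 by rewrite ltnNge; apply/negP => /mono; lia.
    split=> el; first by apply: win; apply: Or32; exists k; lia.
    by apply: lose; apply: Or32; exists k; lia.
  (* U_2(n) - L + 1 is the bound on [e] in step [q'], and U_1(n) is the bound on [d] in the losing
     step. *)
  + split=> el; first by apply: win; apply: Or32; exists q'; lia.
    by apply: lose; apply: Or32; exists q'; lia.
Qed.
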